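(* Let $H_+(\mathbb T)$ be the Polish topological group of all circular-order preserving homeomorphisms of the circle $\mathbb T$. The minimal circularly ordered dynamical system $(\mathbb T,H_+(\mathbb T))$ is tame but not tame$_{\mathbf 1}$.
   Context: $\mathbb T=\mathbb R/\mathbb Z$ has its standard circular (cyclic) order; $H_+(\mathbb T)$ is the group of homeomorphisms of $\mathbb T$ preserving it (orientation preserving homeomorphisms), with the compact-open topology, acting on $\mathbb T$ in the natural way. For a topological group $T$ acting continuously on a compact metrizable space $X$, the enveloping semigroup $E(X,T)$ is the closure of the set of translations in $X^X$ with the pointwise topology. The system is tame$_{\mathbf 1}$ if $E(X,T)$ is first countable. A sequence $(f_n)$ of real functions on $X$ is independent if there are reals $a<b$ such that $\bigcap_{n\in P}f_n^{-1}((-\infty,a))\cap\bigcap_{n\in M}f_n^{-1}((b,\infty))\neq\emptyset$ for all finite disjoint $P,M\subset\mathbb N$. The system is tame if for every continuous $f\colon X\to\mathbb R$ the family $\{f\circ t:t\in T\}$ contains no infinite independent sequence. *)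

(* Defs.v *)
From HB Require Import structures.
From mathcomp Require Import all_boot all_order all_algebra.
From mathcomp Require Import generic_quotient.
From mathcomp Require Import all_classical all_reals all_analysis.
From mathcomp Require Import lra.
Import Order.TTheory GRing.Theory Num.Theory.
Import numFieldTopology.Exports.

Set Implicit Arguments.
Unset Strict Implicit.
Unset Printing Implicit Defensive.

Local Open Scope classical_set_scope.
Local Open Scope ring_scope.

Definition homeomorphism (X Y : topologicalType) (f : X -> Y) : Prop :=
  continuous f /\
  exists g : Y -> X, [/\ cancel f g, cancel g f & continuous g].

Definition first_countable (X : topologicalType) : Prop :=
  forall x : X, exists B : set (set X),
    [/\ countable B, B `<=` nbhs x &
        forall A, nbhs x A -> exists2 U, B U & U `<=` A].

Definition metrizable (R : realType) (X : topologicalType) : Prop :=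
  exists (M : metricType R) (f : X -> M), homeomorphism f.

Definition completely_metrizable (R : realType) (X : topologicalType) : Prop :=
  exists (M : metricType R) (f : X -> M), homeomorphism f /\
    forall F : set_system M, ProperFilter F -> cauchy F ->
      exists x : M, F --> x.

Definition separable (X : topologicalType) : Prop :=
  exists2 D : set X, countable D & dense D.

Definition polish (R : realType) (X : topologicalType) : Prop :=
  separable X /\ completely_metrizable R X.

(* No compatibility is required here between the group operations and the
   topology: this is what [topological_group] asserts. *)
#[short(type="groupTopologicalType")]
HB.structure Definition GroupTopological := {G of Group G & Topological G}.

Definition topological_group (G : groupTopologicalType) : Prop :=
  continuous (fun p : G * G => (p.1 * p.2)%g) /\
  continuous (fun g : G => (g^-1)%g).

Definition dynamical_system (R : realType) (G : groupTopologicalType)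
    (X : topologicalType) (act : G -> X -> X) : Prop :=
  [/\ topological_group G,
      compact [set: X] /\ metrizable R X,
      (forall x, act 1%g x = x),
      (forall g h x, act (g * h)%g x = act g (act h x)) &
      continuous (fun p : G * X => act p.1 p.2)].

Definition minimal_system (G : Type) (X : topologicalType)
    (act : G -> X -> X) : Prop :=
  forall x : X, dense (range (act^~ x)).

Definition enveloping_semigroup (G : Type) (X : topologicalType)
    (act : G -> X -> X) : set {ptws X -> X} :=
  closure (range act : set {ptws X -> X}).

(* A set coerces to the type of its elements, which carries the subspace
   topology. *)
Definition tame1 (G : Type) (X : topologicalType) (act : G -> X -> X) : Prop :=
  first_countable (enveloping_semigroup act).

Definition independent (R : realType) (X : Type) (f : nat -> X -> R) : Prop :=
  exists a b : R, a < b /\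
    forall P M : set nat, finite_set P -> finite_set M -> P `&` M = set0 ->
      ((\bigcap_(n in P) (f n @^-1` [set r | r < a])) `&`
       (\bigcap_(n in M) (f n @^-1` [set r | b < r]))) !=set0.

(* The terms of an independent sequence are pairwise distinct, so that a
   sequence with values in a family is an infinite subset of it. *)
Definition tame (R : realType) (G : Type) (X : topologicalType)
    (act : G -> X -> X) : Prop :=
  forall f : X -> R, continuous f ->
    ~ exists t : nat -> G, independent (fun n => f \o act (t n)).

Definition circular_order (X : Type) (C : X -> X -> X -> Prop) : Prop :=
  [/\ (forall a b c, C a b c -> C b c a),
      (forall a b c, C a b c -> ~ C b a c),
      (forall a b c d, C a b c -> C a c d -> C a b d) &
      (forall a b c, a <> b -> b <> c -> a <> c -> C a b c \/ C a c b)].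

(* The open intervals form a base of the interval topology when the space has
   at least three points. *)
Definition interval_topology (X : topologicalType)
    (C : X -> X -> X -> Prop) : Prop :=
  forall (x : X) (A : set X),
    nbhs x A <-> exists a b, C a x b /\ [set y | C a y b] `<=` A.

Definition preserves_order (X : Type) (C : X -> X -> X -> Prop)
    (f : X -> X) : Prop :=
  forall a b c, C a b c -> C (f a) (f b) (f c).

Definition circularly_ordered_system (G : Type) (X : topologicalType)
    (C : X -> X -> X -> Prop) (act : G -> X -> X) : Prop :=
  [/\ circular_order C, interval_topology C &
      forall g, preserves_order C (act g)].

Section Circle.
Local Open Scope quotient_scope.
Variable R : realType.

Definition eqmodZ (x y : R) : bool := x - y \is a Num.int.

Lemma eqmodZ_refl : reflexive eqmodZ.
Proof. by move=> x; rewrite /eqmodZ subrr rpred0. Qed.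

Lemma eqmodZ_sym : symmetric eqmodZ.
Proof. by move=> x y; rewrite /eqmodZ -rpredN opprB. Qed.

Lemma eqmodZ_trans : transitive eqmodZ.
Proof.
move=> y x z xy yz; rewrite /eqmodZ.
have -> : x - z = (x - y) + (y - z) by rewrite addrA subrK.
exact: rpredD.
Qed.

Definition eqmodZ_equiv := EquivRel eqmodZ eqmodZ_refl eqmodZ_sym eqmodZ_trans.

Definition circle : Type := quotient_topology {eq_quot eqmodZ_equiv}.
HB.instance Definition _ := Topological.on circle.

Definition circle_proj (x : R) : circle :=
  \pi_(quotient_topology {eq_quot eqmodZ_equiv}) x.

Lemma circle_projP (x y : R) : circle_proj x = circle_proj y <-> eqmodZ x y.
Proof. by split=> [/eqmodP|xy]; [|apply/eqmodP]. Qed.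

Lemma circle_proj_surj (a : circle) : exists x, circle_proj x = a.
Proof. by exists (repr a); rewrite /circle_proj reprK. Qed.

Definition circle_order (a b c : circle) : Prop :=
  exists x y z : R,
    [/\ circle_proj x = a, circle_proj y = b, circle_proj z = c &
        x < y /\ y < z /\ z < x + 1].

Lemma circle_orderP (x y z : R) :
  circle_order (circle_proj x) (circle_proj y) (circle_proj z) <->
  exists m n : int, x < y + m%:~R /\ y + m%:~R < z + n%:~R /\
                    z + n%:~R < x + 1.
Proof.
have projD (u : R) (k : int) : circle_proj (u + k%:~R) = circle_proj u.
  by apply/circle_projP; rewrite /eqmodZ addrC addKr intr_int.
split=> [[x' [y' [z' [ex ey ez [xy [yz zx]]]]]]|[m [n [xy [yz zx]]]]]; last first.
  by exists x, (y + m%:~R), (z + n%:~R); rewrite !projD.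
move/circle_projP/intrP : ex => [i ix].
move/circle_projP/intrP : ey => [j jy].
move/circle_projP/intrP : ez => [k kz].
by exists (j - i), (k - i); rewrite !intrB; lra.
Qed.

Lemma circle_order_cyclic : forall a b c,
  circle_order a b c -> circle_order b c a.
Proof.
move=> a b c [x [y [z [xa yb zc [xy [yz zx]]]]]].
exists y, z, (x + 1); split=> //; last by lra.
by rewrite -xa; apply/circle_projP; rewrite /eqmodZ addrC addKr rpred1.
Qed.

Lemma circle_order_asym : forall a b c,
  circle_order a b c -> ~ circle_order b a c.
Proof.
move=> a b c [x [y [z [<- <- <- [xy [yz zx]]]]]] /circle_orderP[m [n []]].
move=> yx [xz zy].
have m0 : 0 < m by rewrite -(ltr0z R); lra.
have : 1 <= m%:~R :> R by rewrite ler1z -gtz0_ge1.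
move=> m1; have n0 : 0 < n by rewrite -(ltr0z R); lra.
by have : 1 <= n%:~R :> R; [rewrite ler1z -gtz0_ge1 | lra].
Qed.

Lemma circle_repr_in (x : R) (b : circle) : circle_proj x <> b ->
  exists y : R, [/\ circle_proj y = b, x < y & y < x + 1].
Proof.
have [y0 <-] := circle_proj_surj b => xb.
pose y := y0 - (Num.floor (y0 - x))%:~R.
have yb : circle_proj y = circle_proj y0.
  by apply/circle_projP; rewrite /eqmodZ addrC addKr rpredN intr_int.
have xy : x <> y by move=> xy; apply: xb; rewrite xy.
have := floor_itv (y0 - x); rewrite intrD => /andP[l1 l2].
exists y; split=> //; last by rewrite /y; lra.
by rewrite lt_neqAle; apply/andP; split; [exact/eqP|rewrite /y; lra].
Qed.

Lemma circle_order_total : forall a b c, a <> b -> b <> c -> a <> c ->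
  circle_order a b c \/ circle_order a c b.
Proof.
move=> a b c; have [x <-] := circle_proj_surj a.
move=> /circle_repr_in[y [yb xy yx]] bc /circle_repr_in[z [zc xz zx]].
case: (ltgtP y z) => yz.
- by left; exists x, y, z.
- by right; exists x, z, y.
- by case: bc; rewrite -yb -zc yz.
Qed.

Definition orientation_preserving_homeo : set {compact-open, circle -> circle} :=
  [set h | homeomorphism (h : circle -> circle) /\
           preserves_order circle_order h].

Definition Hplus : Type := orientation_preserving_homeo.
HB.instance Definition _ := Topological.on Hplus.

Definition Hplus_act (h : Hplus) : circle -> circle := set_val h.

Lemma Hplus_actP (h : Hplus) : homeomorphism (Hplus_act h) /\
  preserves_order circle_order (Hplus_act h).
Proof. exact: (set_valP h). Qed.

Lemma Hplus_act_inj : injective Hplus_act.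
Proof. by move=> g h gh; exact: val_inj. Qed.

Definition mkHplus (h : circle -> circle)
    (hP : homeomorphism h /\ preserves_order circle_order h) : Hplus :=
  exist _ (h : {compact-open, circle -> circle}) (mem_set hP).

Lemma id_subproof : homeomorphism (@id circle) /\
  preserves_order circle_order (@id circle).
Proof.
have ctsid : continuous (@id circle) by move=> x; exact: cvg_id.
by split=> //; split=> //; exists id; split.
Qed.

Lemma comp_subproof (g h : Hplus) :
  homeomorphism (Hplus_act g \o Hplus_act h) /\
  preserves_order circle_order (Hplus_act g \o Hplus_act h).
Proof.
have [[cg [g' [gK g'K cg']]] og] := Hplus_actP g.
have [[ch [h' [hK h'K ch']]] oh] := Hplus_actP h.
split; last by move=> a b c abc; apply: og; exact: oh.
split; first by move=> x; apply: continuous_comp; [exact: ch|exact: cg].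
exists (h' \o g'); split; [exact: can_comp|exact: can_comp|].
by move=> x; apply: continuous_comp; [exact: cg'|exact: ch'].
Qed.

Lemma inv_subproof (h : Hplus) : exists g : Hplus,
  cancel (Hplus_act h) (Hplus_act g) /\ cancel (Hplus_act g) (Hplus_act h).
Proof.
have [[ch [h' [hK h'K ch']]] oh] := Hplus_actP h.
suff h'P : homeomorphism h' /\ preserves_order circle_order h'.
  by exists (mkHplus h'P).
split; first by split=> //; exists (Hplus_act h).
have h'N u v : u <> v -> h' u <> h' v.
  by move=> uv /(congr1 (Hplus_act h)); rewrite !h'K.
move=> a b c abc; have irr u v : ~ circle_order u u v.
  by move=> uuv; exact: (circle_order_asym uuv).
have ab : a <> b by move=> ab; move: abc; rewrite ab => /irr.
have bc : b <> c.
  by move=> bc; move: abc; rewrite bc => /circle_order_cyclic/irr.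
have ac : a <> c.
  by move=> ac; move: abc => /circle_order_cyclic/circle_order_cyclic; rewrite ac => /irr.
case: (circle_order_total (h'N _ _ ab) (h'N _ _ bc) (h'N _ _ ac)) => // /oh.
rewrite !h'K => /circle_order_cyclic cba.
by case: (circle_order_asym (circle_order_cyclic abc)).
Qed.

Definition Hplus_one : Hplus := mkHplus id_subproof.
Definition Hplus_mul (g h : Hplus) : Hplus := mkHplus (comp_subproof g h).
Definition Hplus_inv (h : Hplus) : Hplus := sval (cid (inv_subproof h)).

Lemma Hplus_mulA : associative Hplus_mul.
Proof. by move=> f g h; apply: Hplus_act_inj. Qed.

Lemma Hplus_mul1 : left_id Hplus_one Hplus_mul.
Proof. by move=> h; apply: Hplus_act_inj. Qed.

Lemma Hplus_mulr1 : right_id Hplus_one Hplus_mul.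
Proof. by move=> h; apply: Hplus_act_inj. Qed.

Lemma Hplus_mulV : left_inverse Hplus_one Hplus_inv Hplus_mul.
Proof.
move=> h; apply: Hplus_act_inj; apply/funext => x.
by rewrite /Hplus_inv; case: cid => g [+ _] /=; exact.
Qed.

Lemma Hplus_mulrV : right_inverse Hplus_one Hplus_inv Hplus_mul.
Proof.
move=> h; apply: Hplus_act_inj; apply/funext => x.
by rewrite /Hplus_inv; case: cid => g [_ +] /=; exact.
Qed.

HB.instance Definition _ := isGroup.Build Hplus
  Hplus_mulA Hplus_mul1 Hplus_mulr1 Hplus_mulV Hplus_mulrV.

End Circle.

(* Main.v *)
From HB Require Import structures.
Require Import Defs.
From mathcomp Require Import all_boot all_order all_algebra.
From mathcomp Require Import all_classical all_reals all_analysis.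
From mathcomp Require Import ring lra zify.
Import Order.TTheory GRing.Theory Num.Theory.
Import numFieldTopology.Exports.

(** The circle carries the distance [cdist] induced by the distance to the
    nearest integer, and its compactness gives Lebesgue numbers
    ([lebesgue_number]), hence uniform continuity. The compact-open topology on
    the homeomorphism group is that of uniform convergence
    ([Hplus_nbhsP]), from which the continuity of the group operations and of
    the action follows by the usual estimates. Uniform convergence of
    homeomorphisms alone is not complete, but it becomes so once the inverses
    are required to converge too: this is the distance [Hdist]. Separability
    is the classical argument for spaces of maps between compact metric
    spaces: a homeomorphism with a known modulus of continuity is determined,
    up to a small error, by finitely many rounded values. Rotations make the
    action transitive, so minimality is immediate.

    Tameness. Fix a base point [o]. For an orientation preserving [g], the
    position of [g x] on the circle cut at [g o] is a nondecreasing function of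
    the position of [x] on the circle cut at [o] ([act_arclen_le]). Cut the
    target circle into [N.+1] arcs so short that [f] varies by less than
    [b - a] on each. For [n] homeomorphisms, the sum over [i < n] of the indices
    of the arcs containing [g_i x] is then nondecreasing in [x] and
    takes at most [n * N + 1] values; and where it takes the same value twice
    every one of the [n] indices agrees, so that no [f \o g_i] can pass from
    below [a] to above [b]. Independence would yield [2 ^ n] points with
    pairwise different patterns, which is impossible for large [n].

    Failure of first countability. For each point [x], the map [pinch x], which
    sends [x] to one point and everything else to another point [o], is a
    pointwise limit of homeomorphisms: iterate a homeomorphism having one
    repelling and one attracting fixed point, after a rotation bringing [x] to
    the repelling one ([pinch_limit]). As a neighbourhood for pointwise
    convergence constrains finitely many points only, the constant map [o] is
    adherent to the maps [pinch x], and a countable base at it would constrain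
    only countably many points in all. For [x] outside these, [pinch x] would
    lie in every neighbourhood of the constant map, although the two maps differ
    at [x]. *)

Set Implicit Arguments.
Unset Strict Implicit.
Unset Printing Implicit Defensive.

Local Open Scope classical_set_scope.
Local Open Scope ring_scope.

(** * Distances inducing a given topology *)

Definition is_distance (R : realType) (X : Type) (d : X -> X -> R) : Prop :=
  [/\ forall x, d x x = 0, forall x y, d x y = 0 -> x = y,
      forall x y, d x y = d y x & forall y x z, d x z <= d x y + d y z].

(** A copy of [X] that depends on the proof that [d] is a distance, so that
    the metric structure can be attached to it without touching the topology
    that [X] already has. *)
Definition metrized (R : realType) (X : Type) (d : X -> X -> R)
  of is_distance d : Type := X.

Section DistanceSpace.
Variables (R : realType) (X : topologicalType) (d : X -> X -> R).
Variable dP : is_distance d.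
Local Notation M := (metrized dP).

HB.instance Definition _ := Choice.copy M X.

Let dxx (x : X) : d x x = 0. Proof. by case: dP. Qed.
Let d0_eq (x y : X) : d x y = 0 -> x = y.
Proof. by case: dP => _ + _ _; apply. Qed.
Let dC (x y : X) : d x y = d y x. Proof. by case: dP. Qed.
Let d_triangle (y x z : X) : d x z <= d x y + d y z. Proof. by case: dP. Qed.

HB.instance Definition _ := isMetric.Build R M dxx d0_eq dC d_triangle.

Lemma metrized_ballE (x y : M) (e : R) : ball x e y = (d x y < e) :> Prop.
Proof. by rewrite ballEmdist. Qed.

Definition distance_topology : Prop := forall (x : X) (A : set X),
  nbhs x A <-> exists2 e : R, 0 < e & forall y, d x y < e -> A y.

Lemma metrized_homeo :
  distance_topology -> homeomorphism (id : X -> M).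
Proof.
move=> dnbhs; split; last exists (id : M -> X); first last.
- split=> // x A /dnbhs[e e0 eA]; apply/(@nbhs_ballP R M).
  by exists e => // y; rewrite metrized_ballE => /eA.
- move=> x A /(@nbhs_ballP R M)[e e0 eA]; apply/dnbhs.
  by exists e => // y; rewrite -metrized_ballE => /eA.
Qed.

Lemma distance_hausdorff : distance_topology -> hausdorff_space X.
Proof.
move=> dnbhs x y xy; case: dP => _ d0 dsym dtri; apply/d0/eqP.
have ge0 : 0 <= d x y.
  by have := dtri y x x; rewrite dxx dsym; rewrite [d y x]dsym; lra.
rewrite eq_le ge0 andbT leNgt; apply/negP => lt0.
have [] := xy [set z | d x z < d x y / 2] [set z | d y z < d x y / 2].
- by apply/dnbhs; exists (d x y / 2) => //; lra.
- by apply/dnbhs; exists (d x y / 2) => //; lra.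
by move=> z /= []; have := dtri z x y; rewrite (dsym z); lra.
Qed.

End DistanceSpace.

(** * Distance to the nearest integer *)

Section Tnorm.
Variable R : realType.
Implicit Types x y z : R.

Definition tnorm x : R := `|x - (Num.floor (x + 2^-1))%:~R|.

(** The rounding of [x] differs from [x] by at most [1/2], whereas distinct
    integers are at least [1] apart. *)
Lemma tnorm_le x (n : int) : tnorm x <= `|x - n%:~R|.
Proof.
rewrite /tnorm; set m := Num.floor _.
have := floor_itv (x + 2^-1); rewrite -/m intrD => /andP[l1 l2].
have [->//|nm] := eqVneq n m.
have : 1 <= `|(n - m)%:~R : R|.
  rewrite -intr_norm (ler1z R) -gtz0_ge1 normr_gt0 subr_eq0//.
rewrite intrB.
have := ler_normD (n%:~R - x) (x - m%:~R).
have -> : n%:~R - x + (x - m%:~R) = n%:~R - m%:~R by ring.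
rewrite (distrC n%:~R x).
have : `|x - m%:~R| <= 2^-1 by rewrite ler_norml; apply/andP; split; lra.
lra.
Qed.

(** Together with [tnorm_le] this says that [tnorm] is the minimum of [`|x -
    n|] over all integers [n]; periodicity, evenness and subadditivity
    follow from these two facts alone. *)
Lemma tnorm_attained x : exists n : int, tnorm x = `|x - n%:~R|.
Proof. by exists (Num.floor (x + 2^-1)). Qed.

Lemma tnormDz x (n : int) : tnorm (x + n%:~R) = tnorm x.
Proof.
apply/eqP; rewrite eq_le; apply/andP; split.
  have [m ->] := tnorm_attained x; apply: le_trans (tnorm_le _ (m + n)) _.
  by rewrite intrD; have -> : x + n%:~R - (m%:~R + n%:~R) = x - m%:~R by ring.
have [m ->] := tnorm_attained (x + n%:~R).
apply: le_trans (tnorm_le _ (m - n)) _.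
by rewrite intrB; have -> : x - (m%:~R - n%:~R) = x + n%:~R - m%:~R by ring.
Qed.

Lemma tnormN x : tnorm (- x) = tnorm x.
Proof.
suff le y : tnorm (- y) <= tnorm y.
  by apply/eqP; rewrite eq_le le/= -{1}(opprK x) le.
have [m ->] := tnorm_attained y; apply: le_trans (tnorm_le _ (- m)) _.
by rewrite intrN -opprD normrN.
Qed.

Lemma tnormD x y : tnorm (x + y) <= tnorm x + tnorm y.
Proof.
have [m ->] := tnorm_attained x; have [n ->] := tnorm_attained y.
apply: le_trans (tnorm_le _ (m + n)) _; apply: le_trans (ler_normD _ _).
by rewrite intrD opprD addrACA.
Qed.

Lemma tnorm_le_half x : tnorm x <= 2^-1.
Proof.
have := floor_itv (x + 2^-1); rewrite /tnorm intrD ler_norml => /andP[l1 l2].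
by apply/andP; split; lra.
Qed.

Lemma tnorm_ge0 x : 0 <= tnorm x.
Proof. exact: normr_ge0. Qed.

Lemma tnorm_le_norm x : tnorm x <= `|x|.
Proof. by have := tnorm_le x 0; rewrite subr0. Qed.

Lemma tnorm_lip x y : `|tnorm x - tnorm y| <= `|x - y|.
Proof.
apply: le_trans (tnorm_le_norm (x - y)); rewrite ler_norml.
have := tnormD (x - y) y; have := tnormD (y - x) x.
rewrite !subrK -(tnormN (y - x)) opprB; lra.
Qed.

Lemma tnorm_small x : `|x| <= 2^-1 -> tnorm x = `|x|.
Proof.
move=> x2; apply/eqP; rewrite eq_le tnorm_le_norm/=.
have [n ->] := tnorm_attained x.
have [->|n0] := eqVneq n 0; first by rewrite subr0.
have : 1 <= `|n%:~R : R| by rewrite -intr_norm (ler1z R) -gtz0_ge1 normr_gt0.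
have := ler_normD x (n%:~R - x); rewrite (distrC n%:~R) addrCA subrr addr0; lra.
Qed.

Lemma tnorm_pos x : 0 <= x -> x <= 2^-1 -> tnorm x = x.
Proof. by move=> x0 x2; rewrite tnorm_small ger0_norm. Qed.

Lemma tnorm_neg x : - 2^-1 <= x -> x <= 0 -> tnorm x = - x.
Proof. by move=> x2 x0; rewrite tnorm_small ler0_norm// lerNl. Qed.

End Tnorm.

(** * The arc distance on the circle *)

Section CircleDistance.
Variable R : realType.
Implicit Types (x y z : R) (a b c : circle R).

Local Notation pr := (@circle_proj R).

Lemma circle_projDz x (n : int) : pr (x + n%:~R) = pr x.
Proof. by apply/circle_projP; rewrite /eqmodZ addrC addKr intr_int. Qed.

Lemma circle_proj_eqP x y : pr x = pr y <-> exists n : int, y = x + n%:~R.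
Proof.
split=> [/esym/circle_projP/intrP[n xy]|[n ->]]; last by rewrite circle_projDz.
by exists n; rewrite -xy addrC subrK.
Qed.

Definition cdist a b : R := tnorm (repr a - repr b).

Lemma cdist_proj x y : cdist (pr x) (pr y) = tnorm (x - y).
Proof.
have rE z : exists n : int, repr (pr z) = z + n%:~R.
  by apply/circle_proj_eqP; rewrite /circle_proj reprK.
rewrite /cdist; have [m ->] := rE x; have [n ->] := rE y.
rewrite -(tnormDz (x - y) (m - n)) intrB; congr tnorm; ring.
Qed.

(** The form in which the distance is used: closeness on the circle is
    closeness of suitable lifts to the line. *)
Lemma cdist_ltP x b (e : R) :
  cdist (pr x) b < e <-> exists2 y, pr y = b & `|x - y| < e.
Proof.
split=> [|[y <- xy]]; last first.
  by rewrite cdist_proj; apply: le_lt_trans xy; exact: tnorm_le_norm.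
have [y <-] := circle_proj_surj b; rewrite cdist_proj.
have [n ->] := tnorm_attained (x - y) => xy.
by exists (y + n%:~R); rewrite ?circle_projDz// opprD addrA.
Qed.

Lemma cdist_is_distance : is_distance cdist.
Proof.
split=> [a|a b|a b|b a c].
- rewrite /cdist subrr; apply/eqP; rewrite eq_le tnorm_ge0 andbT.
  by have := tnorm_le_norm (0 : R); rewrite normr0.
- rewrite /cdist; have [n ->] := tnorm_attained (repr a - repr b).
  move/normr0_eq0/subr0_eq => ab.
  rewrite -(@reprK _ _ a) -(@reprK _ _ b); apply/(circle_proj_eqP (repr a)).
  by exists (- n); rewrite intrN -ab opprB addrC subrK.
- by rewrite /cdist -tnormN opprB.
- by rewrite /cdist; apply: le_trans (tnormD _ _); rewrite addrA subrK.
Qed.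

Lemma cdistxx a : cdist a a = 0.
Proof. by case: cdist_is_distance. Qed.

Lemma cdistC a b : cdist a b = cdist b a.
Proof. by case: cdist_is_distance. Qed.

Lemma cdist_triangle b a c : cdist a c <= cdist a b + cdist b c.
Proof. by case: cdist_is_distance. Qed.

Lemma cdist_ge0 a b : 0 <= cdist a b.
Proof. exact: tnorm_ge0. Qed.

Lemma cdist_le_half a b : cdist a b <= 2^-1.
Proof. exact: tnorm_le_half. Qed.

Lemma circle_proj_continuous : continuous pr.
Proof. exact: pi_continuous. Qed.

Lemma circle_distance_topology : distance_topology cdist.
Proof.
move=> a A; have [x <-] := circle_proj_surj a; split.
  move/circle_proj_continuous/nbhs_ballP => [e e0 eA].
  by exists e => // _ /cdist_ltP[y <- xy]; exact: eA.
move=> [e e0 eA]; apply: (@filterS _ (nbhs (pr x))) eA _.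
apply: open_nbhs_nbhs; split; last by rewrite /= cdistxx.
rewrite /open /= /quotient_open -/pr openE => y /=.
rewrite cdist_proj => xy; apply/nbhs_ballP; exists (e - tnorm (x - y)) => /=.
  by rewrite subr_gt0.
move=> z; rewrite /ball/= => yz; rewrite -/(pr z) cdist_proj.
have -> : x - z = (x - y) + (y - z) by ring.
have := tnormD (x - y) (y - z); have := tnorm_le_norm (y - z); lra.
Qed.

Lemma circle_nbhs_ball a (e : R) : 0 < e -> nbhs a [set b | cdist a b < e].
Proof. by move=> e0; apply/circle_distance_topology; exists e. Qed.

Lemma circle_hausdorff : hausdorff_space (circle R).
Proof.
exact: distance_hausdorff cdist_is_distance circle_distance_topology.
Qed.

Lemma circle_metrizable : metrizable R (circle R).
Proof.
exists (metrized cdist_is_distance), id.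
exact: metrized_homeo circle_distance_topology.
Qed.

(** The circle is the continuous image of the unit interval. *)
Lemma circle_compact : compact [set: circle R].
Proof.
have -> : [set: circle R] = pr @` `[0, 1].
  apply/seteqP; split=> // a _; have [x <-] := circle_proj_surj a.
  exists (x - (Num.floor x)%:~R); last by rewrite -intrN circle_projDz.
  have := floor_itv x; rewrite intrD /= in_itv/= => /andP[l1 l2].
  by apply/andP; split; lra.
apply: continuous_compact; last exact: segment_compact.
exact: continuous_subspaceT circle_proj_continuous.
Qed.

(** The relation [E] stands for closeness of some kind; if it holds locally,
    compactness makes the radius uniform. Taking for [E] the closeness of
    images gives uniform continuity. *)
Lemma lebesgue_number (E : circle R -> circle R -> Prop) :
    (forall a, exists2 r : R, 0 < r &
       forall b c, cdist a b < r -> cdist a c < r -> E b c) ->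
  exists2 r : R, 0 < r & forall b c, cdist b c < r -> E b c.
Proof.
move=> Eloc; have /compact_near_coveringP/(_ R 0^'+) cov := circle_compact.
have /cov : forall a, [set: circle R] a ->
    \forall b \near a & r \near 0^'+, forall c, cdist b c < r -> E b c.
  move=> a _; have [r r0 rE] := Eloc a.
  exists ([set b | cdist a b < r / 2], [set s | s < r / 2]) => /=.
    split; first by apply: circle_nbhs_ball; lra.
    by apply: nbhs_right_lt; lra.
  move=> [b s] /= [ab sr] c bc; apply: rE; first lra.
  by have := cdist_triangle b a c; lra.
move=> near0; near (0 : R)^'+ => r.
exists r => [//|b c]; apply: (near near0 r) => //.
Unshelve. all: by end_near. Qed.

Lemma circle_unif_continuous (h : circle R -> circle R) (e : R) :
  continuous h -> 0 < e ->
  exists2 r : R, 0 < r & forall a b, cdist a b < r -> cdist (h a) (h b) < e.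
Proof.
move=> hc e0; apply: lebesgue_number => a.
have e2 : 0 < e / 2 by lra.
have /hc/circle_distance_topology[r r0 rh] := circle_nbhs_ball (h a) e2.
exists r => // b c /rh /= hb /rh /= hc'.
by have := cdist_triangle (h a) (h b) (h c); rewrite (cdistC (h b) (h a)); lra.
Qed.

Lemma circle_unif_continuous_fun (f : circle R -> R) (e : R) :
  continuous f -> 0 < e ->
  exists2 r : R, 0 < r & forall a b, cdist a b < r -> `|f a - f b| < e.
Proof.
move=> fc e0; apply: lebesgue_number => a.
have e2 : 0 < e / 2 by lra.
have /fc/circle_distance_topology[r r0 rf] := nbhsx_ballx (f a) _ e2.
exists r => // b c /rf + /rf; rewrite /ball/= => fb fc'.
apply: le_lt_trans (ler_distD (f a) _ _) _; rewrite (distrC (f b)); lra.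
Qed.

End CircleDistance.

(** * The circular order *)

Section CircleOrder.
Variable R : realType.
Implicit Types (x y z : R) (a b c : circle R).

Local Notation pr := (@circle_proj R).
Local Notation C := (@circle_order R).

Definition fract x : R := x - (Num.floor x)%:~R.

Lemma fract_itv x : 0 <= fract x < 1.
Proof.
have := floor_itv x; rewrite intrD /fract => /andP[l1 l2].
by apply/andP; split; lra.
Qed.

Lemma fract_id x : 0 <= x < 1 -> fract x = x.
Proof.
move=> /andP[x0 x1]; rewrite /fract (@floor_def _ x 0) ?subr0//.
by rewrite add0r x0.
Qed.

Lemma fractDz x (n : int) : fract (x + n%:~R) = fract x.
Proof. by rewrite /fract floorDrz ?intr_int// intrKfloor intrD; ring. Qed.

(** Length of the positively oriented arc from [a] to [b], that is, the
    position of [b] on the circle cut at [a]. *)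
Definition arclen a b : R := fract (repr b - repr a).

Lemma arclen_proj x y : arclen (pr x) (pr y) = fract (y - x).
Proof.
have rE z : exists n : int, repr (pr z) = z + n%:~R.
  by apply/circle_proj_eqP; rewrite /circle_proj reprK.
rewrite /arclen; have [m ->] := rE x; have [n ->] := rE y.
rewrite -(fractDz (y - x) (n - m)) intrB; congr fract; ring.
Qed.

Lemma arclen_itv a b : 0 <= arclen a b < 1.
Proof. exact: fract_itv. Qed.

Lemma proj_arclen x b : pr (x + arclen (pr x) b) = b.
Proof.
have [y <-] := circle_proj_surj b.
rewrite arclen_proj /fract addrCA addrA subrK.
by rewrite -intrN circle_projDz.
Qed.

Lemma arclen_proj_id x y : x <= y < x + 1 -> arclen (pr x) (pr y) = y - x.
Proof.
by move=> /andP[xy yx]; rewrite arclen_proj fract_id//; apply/andP; split; lra.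
Qed.

Lemma arclenxx a : arclen a a = 0.
Proof.
have [x <-] := circle_proj_surj a.
by rewrite arclen_proj_id ?subrr//; apply/andP; split; lra.
Qed.

Lemma arclen_inj a b c : arclen a b = arclen a c -> b = c.
Proof.
have [x <-] := circle_proj_surj a => bc.
by rewrite -(proj_arclen x b) bc proj_arclen.
Qed.

Lemma cdist_le_arclen a b c : cdist b c <= `|arclen a b - arclen a c|.
Proof.
have [x <-] := circle_proj_surj a.
rewrite -{1}(proj_arclen x b) -{1}(proj_arclen x c) cdist_proj.
apply: le_trans (tnorm_le_norm _) _.
by rewrite opprD addrACA subrr add0r.
Qed.

(** Cutting the circle at [a] turns the ternary cyclic order into the linear
    order of positions; transitivity becomes that of [<]. *)
Lemma circle_order_arclenP a b c :
  C a b c <-> 0 < arclen a b /\ arclen a b < arclen a c.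
Proof.
split=> [[x [y [z [<- <- <- [xy [yz zx]]]]]]|[ab bc]].
  by rewrite !arclen_proj_id; [lra|apply/andP; split; lra..].
have [x xa] := circle_proj_surj a; move: ab bc; rewrite -xa => ab bc.
exists x, (x + arclen (pr x) b), (x + arclen (pr x) c).
split=> //; try exact: proj_arclen.
by have := arclen_itv (pr x) c; move=> /andP[_ c1]; lra.
Qed.

Lemma circle_order_trans a b c d : C a b c -> C a c d -> C a b d.
Proof. by rewrite !circle_order_arclenP; lra. Qed.

Lemma circle_order_circular : circular_order C.
Proof.
split; [exact: circle_order_cyclic|exact: circle_order_asym|
        exact: circle_order_trans|exact: circle_order_total].
Qed.

(** Choose lifts [x < y < z < x + 1] and move each by less than half of the
    smallest of the three gaps. *)
Lemma circle_order_open a b c : C a b c -> exists2 e : R, 0 < e &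
  forall a' b' c', cdist a a' < e -> cdist b b' < e -> cdist c c' < e ->
    C a' b' c'.
Proof.
move=> [x [y [z [<- <- <- [xy [yz zx]]]]]].
pose e := Num.min (y - x) (Num.min (z - y) (x + 1 - z)) / 2.
have [exy eyz ezx] : [/\ e + e <= y - x, e + e <= z - y & e + e <= x + 1 - z].
  by rewrite /e -splitr !ge_min !lexx !orbT.
exists e; first by rewrite /e divr_gt0// !lt_min !subr_gt0 xy yz.
move=> _ _ _ /cdist_ltP[x' <-] + /cdist_ltP[y' <-] + /cdist_ltP[z' <-].
rewrite !ltr_norml => /andP[x1 x2] /andP[y1 y2] /andP[z1 z2].
by exists x', y', z'; split=> //; lra.
Qed.

Lemma circle_interval_topology : interval_topology C.
Proof.
move=> a A; have [x <-] := circle_proj_surj a; split.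
  move=> /circle_distance_topology[e e0 eA].
  pose r := Num.min e 4^-1.
  have r0 : 0 < r by rewrite /r lt_min e0; lra.
  have re : r <= e by rewrite /r ge_min lexx.
  have r4 : r <= 4^-1 by rewrite /r ge_min lexx orbT.
  clearbody r.
  exists (pr (x - r)), (pr (x + r)); split.
    by exists (x - r), x, (x + r); split=> //; lra.
  move=> b /= /circle_order_arclenP[].
  rewrite (arclen_proj_id (_ : _ <= x + r < _)).
    move: (arclen _ b) (proj_arclen (x - r) b) => t <- t0 tr.
    apply: eA; apply/cdist_ltP; eexists; first by [].
    by rewrite ltr_norml; apply/andP; split; lra.
  by apply/andP; split; lra.
move=> [b [c [bxc sub]]]; have [e e0 eC] := circle_order_open bxc.
apply/circle_distance_topology; exists e => // y xy; apply: sub.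
by apply: eC; rewrite // cdistxx.
Qed.

End CircleOrder.

(** * The topology of uniform convergence on the homeomorphism group *)

Section HplusTopology.
Variable R : realType.
Implicit Types (a b c x y : circle R) (g h : Hplus R).

Local Notation act := (@Hplus_act R).

Lemma Hplus_act_continuous h : continuous (act h).
Proof. by have [[]] := Hplus_actP h. Qed.

(** Near a point [x], a compact ball [K] is sent by [h] into a small open
    ball [O]; maps sending [K] into [O] form a neighbourhood of [h] whose
    members are close to [h] on [K]. Compactness of the circle combines
    these local estimates. *)
Lemma Hplus_uniform_nbhs h (e : R) : 0 < e ->
  nbhs h [set g | forall x, cdist (act h x) (act g x) < e].
Proof.
move=> e0.
have /compact_near_coveringP/(_ (Hplus R) (nbhs h)) cov := @circle_compact R.
suff /cov near_all : forall x, [set: circle R] x ->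
    \forall x' \near x & g \near nbhs h, cdist (act h x') (act g x') < e.
  by apply: filterS near_all => g gh x; apply: gh.
move=> x _.
have e2 : 0 < e / 2 by lra.
pose O := [set b | cdist (act h x) b < e / 2]°.
have : nbhs (act h x) O by apply: nbhs_interior; exact: circle_nbhs_ball.
move=> /Hplus_act_continuous/circle_distance_topology[r r0 rO].
have r2 : 0 < r / 2 by lra.
pose K := closure [set b | cdist x b < r / 2].
have cK : compact K.
  apply: (subclosed_compact _ (@circle_compact R)) => //.
  exact: closed_closure.
have KO : act h @` K `<=` O.
  move=> _ [b Kb <-]; apply: rO.
  have [c [/= xc bc]] := Kb _ (circle_nbhs_ball b r2).
  by have := cdist_triangle c x b; rewrite (cdistC c b); lra.
have oW := compact_open_open cK (open_interior _ : open O).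
exists ([set b | cdist x b < r / 2], [set g | act g @` K `<=` O]).
  split=> /=; first exact: circle_nbhs_ball.
  apply: open_nbhs_nbhs; split=> //.
  by exists [set g : circle R -> circle R | g @` K `<=` O].
move=> [x' g] /= [xx' gK].
have Kx' : K x' by exact: subset_closure.
have /interior_subset /= := gK _ (imageP _ Kx').
have /interior_subset /= := KO _ (imageP _ Kx').
have := cdist_triangle (act h x) (act h x') (act g x').
by rewrite (cdistC (act h x') (act h x)); lra.
Qed.

(** The compact-open topology is that of uniform convergence. One half is
    [Hplus_uniform_nbhs]; for the other, an open set containing the compact
    set [h @` K] contains a uniform neighbourhood of it. *)
Lemma Hplus_nbhsP h (A : set (Hplus R)) : nbhs h A <->
  exists2 e : R, 0 < e &
    forall g, (forall x, cdist (act h x) (act g x) < e) -> A g.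
Proof.
split=> [|[e e0 eA]]; last exact: filterS eA (Hplus_uniform_nbhs h e0).
move=> [_ /= [[W oW <-] /= Wh WA]].
pose G : set_system (circle R -> circle R) := filter_from [set e : R | 0 < e]
  (fun e => [set g | forall x, cdist (act h x) (g x) < e]).
have GF : Filter G.
  apply: filter_from_filter; first by exists 1; rewrite /=.
  move=> d e /= d0 e0; exists (Num.min d e); first by rewrite lt_min d0.
  by move=> g gh; split=> x; have := gh x; rewrite lt_min => /andP[].
suff /(_ W) : {compact-open, G --> act h}.
  move=> [|e e0 eW]; first exact: open_nbhs_nbhs.
  by exists e => // g /eW/WA.
apply/compact_open_cvgP => K O cK oO hKO.
have /compact_near_coveringP/(_ R 0^'+) cov := cK.
have /cov near0 : forall x, K x -> \forall x' \near x & e \near 0^'+,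
    forall b, cdist (act h x') b < e -> O b.
  move=> x Kx; have /circle_distance_topology[r r0 rO] : nbhs (act h x) O.
    by apply: open_nbhs_nbhs; split=> //; apply: hKO; exists x.
  have r2 : 0 < r / 2 by lra.
  exists (act h @^-1` [set b | cdist (act h x) b < r / 2], [set s | s < r / 2]).
    split=> /=; last exact: nbhs_right_lt.
    by apply: Hplus_act_continuous; exact: circle_nbhs_ball.
  move=> [x' s] /= [xx' sr] b x'b; apply: rO.
  by have := cdist_triangle (act h x') (act h x) b; lra.
near (0 : R)^'+ => e.
have e0 : 0 < e by [].
exists e => // g gh _ [x Kx <-].
have near_e := near near0 e; exact: (near_e _ x Kx).
Unshelve. all: by end_near. Qed.

Lemma Hplus_nbhs_ball h (e : R) (A : set (Hplus R)) : 0 < e ->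
  (forall g, (forall x, cdist (act h x) (act g x) < e) -> A g) -> nbhs h A.
Proof. by move=> e0 eA; apply/Hplus_nbhsP; exists e. Qed.

Lemma Hplus_actV h : cancel (act h) (act h^-1%g).
Proof.
move=> x; rewrite -[LHS]/(act (h^-1 * h)%g x) mulVg //.
Qed.

Lemma Hplus_actVK h : cancel (act h^-1%g) (act h).
Proof. by move=> x; rewrite -[LHS]/(act (h * h^-1)%g x) mulgV. Qed.

Lemma Hplus_act_unif h (e : R) : 0 < e ->
  exists2 r : R, 0 < r &
    forall a b, cdist a b < r -> cdist (act h a) (act h b) < e.
Proof. exact/circle_unif_continuous/Hplus_act_continuous. Qed.

(** For [x = g y], the distance from [h^-1 x] to [g^-1 x] is that from [h^-1
    (g y)] to [h^-1 (h y)], so the uniform continuity of [h^-1] suffices. *)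
Lemma Hplus_inv_near h (e : R) : 0 < e -> exists2 r : R, 0 < r &
  forall g, (forall x, cdist (act h x) (act g x) < r) ->
    forall x, cdist (act h^-1%g x) (act g^-1%g x) < e.
Proof.
move=> e0; have [r r0 hr] := Hplus_act_unif h^-1%g e0.
exists r => // g hg x; set y := act g^-1%g x.
by rewrite -(Hplus_actVK g x) -/y -{2}(Hplus_actV h y) cdistC; apply: hr.
Qed.

Lemma Hplus_topological_group : topological_group (Hplus R).
Proof.
split=> [[g h]|h] A /Hplus_nbhsP[e e0 eA] /=; last first.
  have [r r0 hr] := Hplus_inv_near h e0.
  by apply: (Hplus_nbhs_ball r0) => g /hr; exact: eA.
have e2 : 0 < e / 2 by lra.
have [r r0 gr] := Hplus_act_unif g e2.
exists ([set g' | forall x, cdist (act g x) (act g' x) < e / 2],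
        [set h' | forall x, cdist (act h x) (act h' x) < r]) => /=.
  by split; apply: Hplus_uniform_nbhs.
move=> [g' h'] /= [gg' hh']; apply: eA => x /=.
have := cdist_triangle (act g (act h' x)) (act g (act h x)) (act g' (act h' x)).
rewrite -[act (g * h)%g x]/(act g (act h x)).
rewrite -[act (g' * h')%g x]/(act g' (act h' x)).
by have := gr _ _ (hh' x); have := gg' (act h' x); lra.
Qed.

Lemma Hplus_dynamical_system : dynamical_system R act.
Proof.
split.
- exact: Hplus_topological_group.
- split; [exact: circle_compact|exact: circle_metrizable].
- by [].
- by [].
move=> [g x] A /circle_distance_topology[e e0 eA].
have e2 : 0 < e / 2 by lra.
have [r r0 gr] := Hplus_act_unif g e2.
exists ([set g' | forall y, cdist (act g y) (act g' y) < e / 2],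
        [set y | cdist x y < r]) => /=.
  by split; [exact: Hplus_uniform_nbhs|exact: circle_nbhs_ball].
move=> [g' y] /= [gg' xy]; apply: eA => /=.
have := cdist_triangle (act g y) (act g x) (act g' y).
by have := gr _ _ xy; have := gg' y; lra.
Qed.

Lemma Hplus_circularly_ordered :
  circularly_ordered_system (@circle_order R) act.
Proof.
split; [exact: circle_order_circular|exact: circle_interval_topology|].
by move=> g; have [] := Hplus_actP g.
Qed.

End HplusTopology.

(** * Complete metrizability *)

Section SupDistance.
Variable R : realType.
Implicit Types (f g h : circle R -> circle R).

Definition supdist f g : R := sup (range (fun x => cdist (f x) (g x))).

Lemma supdist_ge f g x : cdist (f x) (g x) <= supdist f g.
Proof.
apply: ub_le_sup; last by exists x.
by exists 2^-1 => _ [y _ <-]; exact: cdist_le_half.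
Qed.

Lemma supdist_le f g (e : R) :
  (forall x, cdist (f x) (g x) <= e) -> supdist f g <= e.
Proof.
move=> fge; apply: ge_sup; last by move=> _ [y _ <-].
pose o : circle R := circle_proj 0.
by exists (cdist (f o) (g o)); exists o.
Qed.

Lemma supdist_is_distance : is_distance supdist.
Proof.
have [_ d0 dC dtri] := cdist_is_distance R.
have ge0 f g : 0 <= supdist f g.
  exact: le_trans (cdist_ge0 _ _) (supdist_ge f g (circle_proj 0)).
split=> [f|f g fg|f g|g f h].
- apply/eqP; rewrite eq_le ge0 andbT; apply: supdist_le => x.
  by rewrite cdistxx.
- apply/funext => x; apply: d0; apply/eqP.
  by rewrite eq_le cdist_ge0 andbT -fg supdist_ge.
- by congr (sup (_ @` setT)); apply/funext => x; rewrite dC.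
apply: supdist_le => x; apply: le_trans (dtri (g x) _ _) _.
by apply: lerD; exact: supdist_ge.
Qed.

End SupDistance.

Section UniformLimits.
Variable R : realType.
Implicit Types (f g h : circle R -> circle R).

(** Compactness provides a cluster point of the values at each [x], and the
    Cauchy condition turns it into a limit; as the condition is uniform in
    [x], so is the convergence. *)
Lemma uniform_limit (T : Type) (F : set_system T)
    (k : T -> circle R -> circle R) : ProperFilter F ->
    (forall e : R, 0 < e -> exists2 A, F A &
       forall s t, A s -> A t -> forall x, cdist (k s x) (k t x) < e) ->
  exists f, forall e : R, 0 < e ->
    F [set t | forall x, cdist (k t x) (f x) < e].
Proof.
move=> FF kF.
have lim x : exists y, forall e : R, 0 < e -> F [set t | cdist (k t x) y < e].
  have [|y [_ yF]] := @circle_compact R (k^~ x @ F) _; first exact: filterT.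
  exists y => e e0; have e2 : 0 < e / 2 by lra.
  have [A FA Ae] := kF _ e2.
  have FkA : (k^~ x @ F) (k^~ x @` A).
    by apply: (@filterS _ F _ A) FA => s As; exists s.
  have [_ [[s As <-] ys]] := yF _ _ FkA (circle_nbhs_ball y e2).
  apply: filterS FA => t At /=.
  have := cdist_triangle (k s x) (k t x) y; have := Ae _ _ At As x.
  by rewrite (cdistC (k s x) y); move: ys => /=; lra.
have [f fE] := choice lim; exists f => e e0.
have e2 : 0 < e / 2 by lra.
have [A FA Ae] := kF _ e2.
apply: (filterS _ FA) => t At x.
have [s [As /= fs]] := filter_ex (filterI FA (fE x _ e2)).
by have := cdist_triangle (k s x) (k t x) (f x); have := Ae _ _ At As x; lra.
Qed.

Lemma uniform_limit_continuous (T : Type) (F : set_system T)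
    (k : T -> circle R -> circle R) f : ProperFilter F ->
    (forall t, continuous (k t)) ->
    (forall e : R, 0 < e -> F [set t | forall x, cdist (k t x) (f x) < e]) ->
  continuous f.
Proof.
move=> FF kc kf x A /circle_distance_topology[e e0 eA].
have e3 : 0 < e / 3 by lra.
have [t /= tf] := filter_ex (kf _ e3).
have kt : nbhs x (k t @^-1` [set b | cdist (k t x) b < e / 3]).
  by apply: kc; exact: circle_nbhs_ball.
rewrite nbhs_filterE; apply: (filterS _ kt) => y /= xy; apply: eA.
have := cdist_triangle (k t x) (f x) (f y).
have := cdist_triangle (k t y) (k t x) (f y).
by have := tf x; have := tf y; rewrite (cdistC (f x) (k t x)); lra.
Qed.

(** A limit of order preserving maps could only degenerate by identifying
    points, which injectivity excludes. If it reversed a triple, nearby maps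
    would reverse it too since the cyclic order is open. *)
Lemma limit_preserves_order (T : Type) (F : set_system T)
    (k : T -> circle R -> circle R) f : ProperFilter F ->
    (forall t, preserves_order (@circle_order R) (k t)) -> injective f ->
    (forall e : R, 0 < e -> F [set t | forall x, cdist (k t x) (f x) < e]) ->
  preserves_order (@circle_order R) f.
Proof.
move=> FF ko finj kf a b c abc.
have [ab ac] := (circle_order_arclenP a b c).1 abc.
have neq u v : arclen a u < arclen a v -> f u <> f v.
  by move=> uv /finj uv'; move: uv; rewrite uv' ltxx.
have nab : f a <> f b by apply: neq; rewrite arclenxx.
have nbc : f b <> f c by apply: neq.
have nac : f a <> f c by apply: neq; rewrite arclenxx; lra.
have [//|/circle_order_open[e e0 eC]] := circle_order_total nab nbc nac.
have [t /= tf] := filter_ex (kf _ e0).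
have acb : circle_order (k t a) (k t c) (k t b) by apply: eC; rewrite cdistC.
have := circle_order_cyclic (circle_order_cyclic (ko t _ _ _ abc)).
by move/(circle_order_asym acb).
Qed.

End UniformLimits.

Section Polish.
Variable R : realType.
Implicit Types (g h : Hplus R).

Local Notation act := (@Hplus_act R).

(** A uniform limit of homeomorphisms may collapse an arc; the second term
    rules this out by making the inverses converge as well. *)
Definition Hdist g h : R :=
  supdist (act g) (act h) + supdist (act g^-1%g) (act h^-1%g).

Lemma Hdist_is_distance : is_distance Hdist.
Proof.
have [sxx s0 sC stri] := supdist_is_distance R.
have ge0 u v : 0 <= supdist u v :> R.
  exact: le_trans (cdist_ge0 _ _) (supdist_ge u v (circle_proj 0)).
split=> [h|g h gh|g h|h g k].
- by rewrite /Hdist !sxx addr0.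
- apply/Hplus_act_inj/s0; move: gh; rewrite /Hdist.
  have := ge0 (act g) (act h); have := ge0 (act g^-1%g) (act h^-1%g); lra.
- by rewrite /Hdist sC [X in _ + X]sC.
- rewrite /Hdist addrACA; exact: lerD.
Qed.

Lemma Hdist_ge g h x : cdist (act g x) (act h x) <= Hdist g h.
Proof.
apply: le_trans (supdist_ge (act g) (act h) x) _; rewrite /Hdist lerDl.
exact: le_trans (cdist_ge0 _ _) (supdist_ge _ _ x).
Qed.

Lemma Hdist_geV g h x : cdist (act g^-1%g x) (act h^-1%g x) <= Hdist g h.
Proof.
apply: le_trans (supdist_ge (act g^-1%g) (act h^-1%g) x) _.
rewrite /Hdist lerDr.
exact: le_trans (cdist_ge0 _ _) (supdist_ge _ _ x).
Qed.

Lemma Hdist_le g h (e : R) :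
  (forall x, cdist (act g x) (act h x) <= e) ->
  (forall x, cdist (act g^-1%g x) (act h^-1%g x) <= e) -> Hdist g h <= e + e.
Proof. by move=> gh ghV; apply: lerD; apply: supdist_le. Qed.

Lemma Hplus_distance_topology : distance_topology Hdist.
Proof.
move=> h A; split.
  move=> /Hplus_nbhsP[e e0 eA]; exists e => // g hg; apply: eA => x.
  exact: le_lt_trans (Hdist_ge h g x) hg.
move=> [e e0 eA]; have e3 : 0 < e / 3 by lra.
have [r r0 hr] := Hplus_inv_near h e3.
apply: (filterS _ (filterI (Hplus_uniform_nbhs h e3)
                          (Hplus_uniform_nbhs h r0))) => g [/= hg /hr hgV].
apply: eA.
apply: (@le_lt_trans _ _ (e / 3 + e / 3)); last lra.
by apply: Hdist_le => x; exact: ltW.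
Qed.

(** A Cauchy filter has uniform limits [f] of the maps and [f'] of their
    inverses, and both compositions pass to the limit by uniform continuity,
    so that [f] is a homeomorphism with inverse [f']. *)
Lemma Hplus_completely_metrizable : completely_metrizable R (Hplus R).
Proof.
exists (metrized Hdist_is_distance), id; split.
  exact: metrized_homeo Hplus_distance_topology.
move=> F FF cF.
have cau (e : R) : 0 < e -> exists2 A : set (Hplus R), F A &
    forall g h, A g -> A h -> Hdist g h < e.
  move=> e0; have [[A B] /= [FA FB] ABe] := (cauchy_ballP F).2 cF e e0.
  exists (A `&` B) => [|g h [Ag _] [_ Bh]]; first exact: filterI.
  by have := ABe (g, h) (conj Ag Bh); rewrite metrized_ballE.
have [e e0|f fF] := @uniform_limit R _ F act FF.
  have [A FA Ae] := cau e e0; exists A => // g h Ag Ah x.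
  exact: le_lt_trans (Hdist_ge g h x) (Ae _ _ Ag Ah).
have [e e0|f' f'F] := @uniform_limit R _ F (fun h => act h^-1%g) FF.
  have [A FA Ae] := cau e e0; exists A => // g h Ag Ah x.
  exact: le_lt_trans (Hdist_geV g h x) (Ae _ _ Ag Ah).
have fc : continuous f.
  apply: (uniform_limit_continuous FF _ fF) => h.
  exact: Hplus_act_continuous.
have f'c : continuous f'.
  apply: (uniform_limit_continuous FF _ f'F) => h.
  exact: Hplus_act_continuous.
have canc (k k' : Hplus R -> circle R -> circle R) u u' :
    continuous u' -> (forall h, cancel (k h) (k' h)) ->
    (forall e : R, 0 < e -> F [set t | forall x, cdist (k t x) (u x) < e]) ->
    (forall e : R, 0 < e -> F [set t | forall x, cdist (k' t x) (u' x) < e]) ->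
    cancel u u'.
  move=> u'c kK ku ku' x; have [_ d0 _ _] := cdist_is_distance R; apply: d0.
  apply/eqP; rewrite eq_le cdist_ge0 andbT; apply/ler_addgt0Pl => e e0.
  rewrite addr0; have e2 : 0 < e / 2 by lra.
  have [r r0 ur] := circle_unif_continuous u'c e2.
  have [t [/= tu tu']] := filter_ex (filterI (ku _ r0) (ku' _ e2)).
  have := cdist_triangle (u' (k t x)) (u' (u x)) x.
  have := ur _ _ (tu x); have := tu' (k t x); rewrite kK.
  by rewrite (cdistC (u' (k t x))) (cdistC x); lra.
pose actV h := act h^-1%g.
have fK : cancel f f' by apply: (canc act actV f f' f'c (@Hplus_actV R)).
have f'K : cancel f' f by apply: (canc actV act f' f fc (@Hplus_actVK R)).
have fP : homeomorphism f /\ preserves_order (@circle_order R) f.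
  split; first by split=> //; exists f'; split.
  apply: (limit_preserves_order FF _ (can_inj fK) fF) => h.
  by have [] := Hplus_actP h.
pose h : Hplus R := mkHplus fP.
have hV : act h^-1%g = f'.
  by apply/funext => x; rewrite -{1}(f'K x) -[f _]/(act h _) Hplus_actV.
exists h; apply/fcvg_ballP => e e0; have e3 : 0 < e / 3 by lra.
apply: filterS (filterI (fF _ e3) (f'F _ e3)) => g [/= gf gf'].
rewrite metrized_ballE; apply: (@le_lt_trans _ _ (e / 3 + e / 3)); last lra.
by apply: Hdist_le => x; rewrite ?hV cdistC; exact: ltW.
Qed.

End Polish.

(** * Separability *)

Section Separable.
Variable R : realType.
Implicit Types (g h : Hplus R).

Local Notation act := (@Hplus_act R).
Local Notation pr := (@circle_proj R).

(** Index of the arc containing [a] when the circle, cut at [o], is divided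
    into [N.+1] arcs of equal length. *)
Definition cell (N : nat) (o a : circle R) : nat :=
  Num.truncn (N.+1%:R * arclen o a).

Lemma cell_itv N o a :
  (cell N o a)%:R <= N.+1%:R * arclen o a < (cell N o a).+1%:R.
Proof.
by apply/truncn_itv/mulr_ge0; [rewrite ler0n|have /andP[] := arclen_itv o a].
Qed.

Lemma cell_cdist N o a b : cell N o a = cell N o b -> cdist a b < N.+1%:R^-1.
Proof.
move=> ab; apply: le_lt_trans (cdist_le_arclen o a b) _.
have N0 : 0 < N.+1%:R :> R by rewrite ltr0n.
rewrite -(ltr_pM2l N0) divff ?gt_eqF// -{1}(gtr0_norm N0) -normrM mulrBr.
have /andP[] := cell_itv N o a; have /andP[] := cell_itv N o b.
by rewrite ab -natr1 ltr_norml; move=> *; apply/andP; split; lra.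
Qed.

Lemma cell_le N o a : (cell N o a <= N)%N.
Proof.
have /andP[a0 a1] := arclen_itv o a.
rewrite truncn_le_nat -[ltRHS]mulr1 ltr_pM2l// ltr0n//.
Qed.

Definition node (N i : nat) : circle R := pr (i%:R / N.+1%:R).

Lemma cell_node N a : cdist a (node N (cell N (pr 0) a)) < N.+1%:R^-1.
Proof.
have N0 : 0 < N.+1%:R :> R by rewrite ltr0n.
rewrite -{1}(proj_arclen 0 a) /node cdist_proj add0r.
apply: le_lt_trans (tnorm_le_norm _) _.
rewrite -(ltr_pM2l N0) divff ?gt_eqF// -{1}(gtr0_norm N0) -normrM mulrBr.
rewrite [X in _ - X]mulrC divfK ?gt_eqF//.
have /andP[] := cell_itv N (pr 0) a.
by rewrite -natr1 ltr_norml; move=> *; apply/andP; split; lra.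
Qed.

(** The finite data that nearly determine a homeomorphism: the cells of the
    images of the division points. *)
Definition sketch (N : nat) h : seq nat :=
  mkseq (fun i => cell N (pr 0) (act h (node N i))) N.+1.

(** The sketch controls the values at the division points only; the modulus
    of continuity carries this control over to the points in between. *)
Definition sketch_class (i : nat * nat * seq nat) : set (Hplus R) :=
  [set h | sketch i.1.1 h = i.2 /\ forall a b, cdist a b < i.1.1.+1%:R^-1 ->
     cdist (act h a) (act h b) < i.1.2.+1%:R^-1].

(** Go from [g x] to [g y], then to [h y], then to [h x], where [y] is the
    division point next to [x]. *)
Lemma sketch_class_near N k s g h x :
  sketch_class (N, k, s) g -> sketch_class (N, k, s) h ->
  cdist (act g x) (act h x) < k.+1%:R^-1 + N.+1%:R^-1 + k.+1%:R^-1.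
Proof.
move=> [/= gs gu] [/= hs hu]; set y := node N (cell N (pr 0) x).
have xy : cdist x y < N.+1%:R^-1 by exact: cell_node.
have : cdist (act g y) (act h y) < N.+1%:R^-1.
  apply: (cell_cdist (o := pr 0)).
  have := congr1 (fun s => nth 0%N s (cell N (pr 0) x)) gs.
  by rewrite -hs !nth_mkseq ?ltnS ?cell_le.
have := gu _ _ xy; have := hu _ _ xy.
have := cdist_triangle (act g y) (act g x) (act h x).
have := cdist_triangle (act h y) (act g y) (act h x).
rewrite (cdistC (act h y) (act h x)).
by move: k.+1%:R^-1 N.+1%:R^-1 => u v; lra.
Qed.

(** One homeomorphism chosen from each nonempty sketch class forms a
    countable dense set: by uniform continuity, each homeomorphism belongs
    to classes with arbitrarily small error and mesh. *)
Lemma Hplus_separable : separable (Hplus R).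
Proof.
pose rep i : Hplus R := xget 1%g (sketch_class i).
exists (range rep).
  exact: sub_countable (card_image_le _ _) (countableP _).
move=> O [h Oh] oO.
have /Hplus_nbhsP[e e0 eO] : nbhs h O by exact: open_nbhs_nbhs.
have inv_small (r : R) : 0 < r -> exists n : nat, n.+1%:R^-1 < r.
  by move=> /ltr_add_invr[n]; rewrite add0r => nr; exists n.
have [k ke] : exists k : nat, k.+1%:R^-1 < e / 3 by apply: inv_small; lra.
have k0 : 0 < k.+1%:R^-1 :> R by rewrite invr_gt0 ltr0n.
have [r r0 hr] := Hplus_act_unif h k0.
have [N] : exists N : nat, N.+1%:R^-1 < Num.min r (e / 3).
  by apply: inv_small; rewrite lt_min r0; lra.
rewrite lt_min => /andP[Nr Ne].
have hP : sketch_class (N, k, sketch N h) h.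
  by split=> //= a b ab; apply: hr; apply: lt_trans Nr.
exists (rep (N, k, sketch N h)); split; last by exists (N, k, sketch N h).
have repP : sketch_class (N, k, sketch N h) (rep (N, k, sketch N h)).
  by apply: xgetPex; exists h.
apply: eO => x; have := sketch_class_near x hP repP.
by move: ke Ne; move: k.+1%:R^-1 N.+1%:R^-1 => u v; lra.
Qed.

Lemma Hplus_polish : polish R (Hplus R).
Proof.
by split; [exact: Hplus_separable|exact: Hplus_completely_metrizable].
Qed.

End Separable.

(** * Homeomorphisms given by lifts to the line *)

Section Lifts.
Variable R : realType.
Local Notation act := (@Hplus_act R).
Local Notation pr := (@circle_proj R).

Definition degree_one_lift (F : R -> R) : Prop :=
  [/\ continuous F, {homo F : x y / x < y} & forall x, F (x + 1) = F x + 1].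

Lemma lift_shift F x (n : int) :
  degree_one_lift F -> F (x + n%:~R) = F x + n%:~R.
Proof.
move=> [_ _ F1].
have Fn y (m : nat) : F (y + m%:R) = F y + m%:R.
  elim: m => [|m IH]; first by rewrite !addr0.
  by rewrite -natr1 !addrA F1 IH.
case: n => m; first exact: Fn.
by rewrite NegzE intrN; apply/eqP; rewrite eq_sym subr_eq -Fn subrK.
Qed.

(** The values of [F] at two consecutive integers enclose [y] if the integer
    is the floor of [y - F 0]. *)
Lemma lift_surj F y : degree_one_lift F -> exists x, F x = y.
Proof.
move=> FP; have [cF _ _] := FP.
pose n := Num.floor (y - F 0).
have := floor_itv (y - F 0); rewrite -/n intrD => /andP[n0 n1].
have [|||x _ <-] := @IVT R F n%:~R (n%:~R + 1) y; last by exists x.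
- by lra.
- exact: continuous_subspaceT.
have F1 : F (n%:~R + 1) = F 0 + n%:~R + 1.
  by have [_ _ ->] := FP; have := lift_shift 0 n FP; rewrite add0r => ->.
have Fn : F n%:~R = F 0 + n%:~R by have := lift_shift 0 n FP; rewrite add0r.
rewrite F1 Fn ge_min le_max; apply/andP; split; apply/orP; [left|right]; lra.
Qed.

(** The induced map is a continuous bijection from a compact space to a
    Hausdorff one, hence a homeomorphism. *)
Lemma lift_Hplus F :
  degree_one_lift F -> exists h, forall x, act h (pr x) = pr (F x).
Proof.
move=> FP; have [cF incF _] := FP.
pose f (a : circle R) := pr (F (repr a)).
have fE x : f (pr x) = pr (F x).
  have : pr (repr (pr x)) = pr x by rewrite /circle_proj reprK.
  rewrite /f => /circle_proj_eqP[n xE]; rewrite [in RHS]xE lift_shift//.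
  by rewrite circle_projDz.
have fc : continuous f.
  apply/quotient_continuous; rewrite (_ : _ \o _ = pr \o F); last first.
    by apply/funext => x /=; rewrite -fE.
  move=> x; apply: continuous_comp; [exact: cF|exact: circle_proj_continuous].
have finj : injective f.
  move=> a b; have [x <-] := circle_proj_surj a.
  have [y <-] := circle_proj_surj b; rewrite !fE => /circle_proj_eqP[n].
  rewrite -(lift_shift x n FP) => Fxy.
  apply/circle_proj_eqP; exists n.
  by case: (ltgtP y (x + n%:~R)) => // /incF; rewrite Fxy ltxx.
have fsurj b : exists a, f a = b.
  have [y <-] := circle_proj_surj b; have [x <-] := lift_surj y FP.
  by exists (pr x); rewrite fE.
have [g gK] := choice fsurj.
have fK : cancel f g by move=> a; apply: finj; rewrite gK.
have fhomeo : homeomorphism f.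
  split=> //; exists g; split=> //; apply/continuous_closedP => A cA.
  have -> : g @^-1` A = f @` A.
    by apply/seteqP; split=> [b Ab|_ [a Aa <-]] /=; [exists (g b)|rewrite fK].
  apply: compact_closed; first exact: circle_hausdorff.
  apply: continuous_compact; first exact: continuous_subspaceT.
  exact: subclosed_compact cA (@circle_compact R) _.
have fP : homeomorphism f /\ preserves_order (@circle_order R) f.
  split=> // a b c [x [y [z [<- <- <- [xy [yz zx]]]]]].
  exists (F x), (F y), (F z); rewrite !fE; split=> //.
  by have [_ _ <-] := FP; do !split; exact: incF.
by exists (mkHplus fP) => x; exact: fE.
Qed.

Lemma rotation_lift (t : R) : degree_one_lift (fun x => x + t).
Proof.
split=> [x|x y|x]; last exact: addrAC; last by rewrite ltrD2r.
by apply: cvgD; [exact: cvg_id|exact: cvg_cst].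
Qed.

Lemma lift_comp (F G : R -> R) :
  degree_one_lift F -> degree_one_lift G -> degree_one_lift (F \o G).
Proof.
move=> [cF iF F1] [cG iG G1]; split=> [x|x y xy|x] /=.
- by apply: continuous_comp; [exact: cG|exact: cF].
- exact/iF/iG.
- by rewrite G1 F1.
Qed.

Lemma lift_iter (F : R -> R) n :
  degree_one_lift F -> degree_one_lift (iter n F).
Proof.
move=> FP; elim: n => [|n IH]; last exact: lift_comp.
by split=> // x; exact: cvg_id.
Qed.

Lemma Hplus_transitive a b : exists h, act h a = b.
Proof.
have [x <-] := circle_proj_surj a; have [y <-] := circle_proj_surj b.
have [h hE] := lift_Hplus (rotation_lift (y - x)).
by exists h; rewrite hE addrC subrK.
Qed.

Lemma Hplus_minimal : minimal_system act.
Proof.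
move=> a O [b Ob] _; have [h hab] := Hplus_transitive a b.
by exists b; split=> //; exists h.
Qed.

End Lifts.

(** * Tameness *)

Section Tame.
Variable R : realType.
Local Notation act := (@Hplus_act R).

(** For triples starting at [o], preservation of the cyclic order is
    monotonicity of the position on the circle cut at [o]. *)
Lemma act_arclen_le (g : Hplus R) (o x y : circle R) :
  arclen o x <= arclen o y ->
  arclen (act g o) (act g x) <= arclen (act g o) (act g y).
Proof.
rewrite le_eqVlt => /orP[/eqP/arclen_inj -> //|xy].
have [x0|x0] := eqVneq (arclen o x) 0.
  have -> : x = o by apply: (@arclen_inj _ o); rewrite x0 arclenxx.
  by rewrite arclenxx; have /andP[] := arclen_itv (act g o) (act g y).
have [_ og] := Hplus_actP g.
have /og/circle_order_arclenP[_ /ltW//] : circle_order o x y.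
apply/circle_order_arclenP; split=> //.
by rewrite lt_neqAle eq_sym x0; have /andP[] := arclen_itv o x.
Qed.

(** The exponent is taken twice as large as [m = 2 * N + 1], so that [m < 2
    ^ m] can be squared. *)
Lemma expn_gt_linear (N : nat) : exists n : nat, (n * N + 1 < 2 ^ n)%N.
Proof.
set m := (N + N).+1.
exists (m + m)%N; rewrite expnD.
have : (m.+1 * m.+1 <= 2 ^ m * 2 ^ m)%N by rewrite leq_mul// ltn_expl.
by apply: leq_trans; rewrite /m; nia.
Qed.

(** Counting argument: the [2 ^ n] patterns of an independent family of size
    [n] inject into [n * N + 1] values of a monotone sum of cell indices. *)
Lemma Hplus_tame : tame R act.
Proof.
move=> f fc [t [a [b [ab indep]]]].
have ba0 : 0 < b - a by lra.
have [r r0 rf] := circle_unif_continuous_fun fc ba0.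
have [N] := ltr_add_invr r0; rewrite add0r => Nr.
have [n nN] := expn_gt_linear N.
have pattern (s : {ffun 'I_n -> bool}) : exists x : circle R,
    forall i : 'I_n, if s i then f (act (t i) x) < a else b < f (act (t i) x).
  pose P := [set (i : nat) | i in [set i : 'I_n | s i]].
  pose M := [set (i : nat) | i in [set i : 'I_n | ~~ s i]].
  have [|||x [xP xM]] := indep P M;
    [exact: finite_image|exact: finite_image| |].
    rewrite -subset0 => _ [[i /= si <-] [j /= sj /val_inj ij]].
    by move: sj; rewrite ij si.
  exists x => i; case: ifP => si; first by apply: (xP i); exists i.
  by apply: (xM i); exists i => //=; rewrite si.
have [p pP] := choice pattern.
pose o : circle R := circle_proj 0.
pose level x (i : 'I_n) := cell N (act (t i) o) (act (t i) x).
(* The sum is what makes the count linear in [n]: as all its terms are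
   monotone, equality of two sums forces equality term by term. *)
pose L s := (\sum_(i < n) level (p s) i)%N.
have levelM x y i : arclen o x <= arclen o y -> (level x i <= level y i)%N.
  move=> xy; apply: le_truncn; rewrite ler_wpM2l ?ler0n//.
  exact: act_arclen_le.
have L_le s : (L s < n * N + 1)%N.
  rewrite addn1 ltnS; apply: (@leq_trans (\sum_(i < n) N)%N).
    by apply: leq_sum => i _; exact: cell_le.
  by rewrite sum_nat_const card_ord.
have Linj : injective (fun s => Ordinal (L_le s)).
  suff wl s s' : arclen o (p s) <= arclen o (p s') -> L s = L s' -> s = s'.
    move=> s s' [LE]; have [|/ltW] := leP (arclen o (p s)) (arclen o (p s')).
      by move=> /wl; apply.
    by move=> /wl /(_ (esym LE)).
  move=> ss' LE; apply/ffunP => i.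
  have lE : level (p s) i = level (p s') i.
    have leqs (j : 'I_n) : true -> (level (p s) j <= level (p s') j
        ?= iff (level (p s) j == level (p s') j))%N.
      by move=> _; apply/leqif_eq/levelM.
    have [_] := leqif_sum leqs; rewrite -/(L s) -/(L s') LE eqxx.
    by move=> /esym/forallP/(_ i)/eqP.
  have := rf _ _ (lt_trans (cell_cdist lE) Nr).
  have := pP s i; have := pP s' i.
  by case: (s i); case: (s' i) => // h1 h2; rewrite ltr_norml => /andP[]; lra.
have := leq_card _ Linj; rewrite card_ffun card_bool !card_ord.
by rewrite leqNgt nN.
Qed.

End Tame.

(** * Elements of the enveloping semigroup collapsing all but one point *)

Section Pinch.
Variable R : realType.
Local Notation act := (@Hplus_act R).
Local Notation pr := (@circle_proj R).

(** The subtracted term is half of a triangle wave of period [1] and slope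
    [1] or [-1], with zeros at the multiples of [1/2], positive modulo [1]
    on [(0, 1/2)] and negative on [(1/2, 1)]. Hence [0] attracts and [1/2]
    repels. *)
Definition drift (s : R) : R := s - (tnorm (s + 4^-1) - 4^-1) / 2.

(** The triangle wave is 1-Lipschitz, so halving it leaves [drift] strictly
    increasing. *)
Lemma drift_lift : degree_one_lift drift.
Proof.
have lip x y : `|drift x - drift y - (x - y)| <= `|x - y| / 2.
  rewrite /drift; set u := tnorm _; set v := tnorm _.
  have -> : x - (u - 4^-1) / 2 - (y - (v - 4^-1) / 2) - (x - y) = (v - u) / 2.
    by field.
  rewrite normrM (gtr0_norm (_ : 0 < 2^-1)) ?invr_gt0// ler_pM2r ?invr_gt0//.
  apply: le_trans (tnorm_lip _ _) _; rewrite (_ : _ - _ = y - x) 1?distrC//.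
  by ring.
split=> [x|x y xy|x].
- apply/cvgrPdist_lt => e e0; have e2 : 0 < e / 2 by lra.
  near=> y.
  have xy : `|x - y| < e / 2.
    by near: y; apply: cvgr_dist_lt => //; exact: cvg_id.
  have := lip x y; have := ler_normD (drift x - drift y - (x - y)) (x - y).
  by rewrite subrK; lra.
- have := lip y x; rewrite (gtr0_norm (_ : 0 < y - x)) ?subr_gt0//.
  by rewrite ler_norml => /andP[]; lra.
- by rewrite /drift (_ : x + 1 + 4^-1 = x + 4^-1 + 1%:~R) ?tnormDz; ring.
Unshelve. all: by end_near. Qed.

Lemma drift_half : drift 2^-1 = 2^-1.
Proof.
rewrite /drift; have -> : 2^-1 + 4^-1 = - 4^-1 + 1%:~R :> R by field.
rewrite tnormDz tnorm_neg; [|lra|lra].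
by rewrite opprK subrr mul0r subr0.
Qed.

(** In absolute value, the triangle wave at [t] is the smaller of [`|t|] and
    [1/2 - `|t|], which is at least [2 * e * `|t|]; half of it is removed
    from [`|t|]. *)
Lemma drift_contract (e t : R) : 0 <= e -> `|t| <= 2^-1 - e ->
  `|drift t| <= (1 - e) * `|t|.
Proof.
move=> e0 te; have t_ge0 := normr_ge0 t.
have : 0 <= (2^-1 - e - `|t|) * (2^-1 + e) by rewrite mulr_ge0//; lra.
have : 0 <= (2^-1 - e) * `|t| by rewrite mulr_ge0//; lra.
have e2 : 0 <= e * e by exact: mulr_ge0.
rewrite /drift; move: te {t_ge0}; have [t0|t0] := ger0P t => te h1 h2.
  have [t4|t4] := leP t 4^-1.
    by rewrite tnorm_pos; [|lra|lra]; rewrite ger0_norm; [lra|lra].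
  have -> : t + 4^-1 = (t - 3 / 4) + 1%:~R by field.
  by rewrite tnormDz tnorm_neg; [|lra|lra]; rewrite ger0_norm; [lra|lra].
have [t4|t4] := leP (- 4^-1) t.
  by rewrite tnorm_pos; [|lra|lra]; rewrite ler0_norm; [lra|lra].
by rewrite tnorm_neg; [|lra|lra]; rewrite ler0_norm; [lra|lra].
Qed.

Lemma drift_iter_cvg (t : R) : `|t| < 2^-1 ->
  iter n drift t @[n --> \oo] --> (0 : R).
Proof.
move=> t2; pose e := 2^-1 - `|t|.
have e0 : 0 < e by rewrite subr_gt0.
have bound n : `|iter n drift t| <= (1 - e) ^+ n * `|t|.
  elim: n => [|n IH]; first by rewrite mul1r.
  have le_t : `|iter n drift t| <= `|t|.
    apply: le_trans IH _; rewrite ler_piMl// exprn_ile1// /e;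
      have := normr_ge0 t; lra.
  rewrite iterS exprS -mulrA.
  apply: le_trans (drift_contract (ltW e0) _) _; first by rewrite /e; lra.
  by rewrite ler_wpM2l//; rewrite /e; have := normr_ge0 t; lra.
apply/norm_cvg0P.
apply: (@squeeze_cvgr _ _ _ _ (fun=> 0) (fun n => (1 - e) ^+ n * `|t|)).
- by near=> n; rewrite normr_ge0 bound.
- exact: cvg_cst.
- rewrite -[X in _ --> X](mul0r `|t|); apply: cvgMl; apply: cvg_expr.
  by rewrite ger0_norm /e; have := normr_ge0 t; lra.
Unshelve. all: by end_near. Qed.

Definition pinch (x : circle R) : circle R -> circle R :=
  fun a => if a == x then pr 2^-1 else pr 0.

(** Rotate [x] to [1/2], the repelling fixed point of [drift], and iterate
    [drift]. *)
Lemma pinch_limit (x : circle R) : exists h : nat -> Hplus R,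
  forall a, act (h n) a @[n --> \oo] --> pinch x a.
Proof.
have [y <-] := circle_proj_surj x.
pose F n := iter n drift \o (fun s => s + (2^-1 - y)).
have FP n : degree_one_lift (F n).
  exact: lift_comp (lift_iter n drift_lift) (rotation_lift _).
have [h hE] := choice (fun n => lift_Hplus (FP n)).
exists h => a.
have [t ta t2] : exists2 t, pr (t - (2^-1 - y)) = a & `|t| <= 2^-1.
  have [s <-] := circle_proj_surj a.
  have [n] := tnorm_attained (s + (2^-1 - y)) => nE.
  exists (s + (2^-1 - y) - n%:~R); last first.
    by rewrite -nE; exact: tnorm_le_half.
  by rewrite addrAC addrK -intrN circle_projDz.
rewrite -ta; have hnE n : act (h n) (pr (t - (2^-1 - y))) = pr (iter n drift t).
  by rewrite hE /F /= subrK.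
rewrite (eq_cvg _ _ hnE) /pinch; move: t2; rewrite le_eqVlt => /orP[|] t2.
  have -> : pr (t - (2^-1 - y)) = pr y.
    have [->|->] : t = 2^-1 \/ t = - 2^-1.
      by move: t2; rewrite eqr_norml => /andP[/orP[]/eqP-> _]; [left|right].
    - by congr pr; ring.
    - by rewrite -[RHS](circle_projDz _ (-1)); congr pr; rewrite intrN; field.
  rewrite eqxx.
  have tE : pr t = pr 2^-1.
    move: t2; rewrite eqr_norml => /andP[/orP[]/eqP-> _] //.
    by rewrite -[RHS](circle_projDz _ (-1)); congr pr; rewrite intrN; field.
  have fixed n : drift (2^-1 + n%:~R) = 2^-1 + n%:~R.
    by rewrite (lift_shift _ _ drift_lift) drift_half.
  have [m tm] := (circle_proj_eqP 2^-1 t).1 (esym tE).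
  rewrite -tE; rewrite (_ : (fun n => _) = (fun=> pr t)); first exact: cvg_cst.
  apply/funext => n; congr pr; elim: n => // n IH.
  by rewrite iterS IH tm fixed.
case: eqP => [/circle_proj_eqP[n nE]|_]; last first.
  exact: (cvg_comp _ _ (drift_iter_cvg t2) (@circle_proj_continuous R 0)).
have : n%:~R = 2^-1 - t :> R by lra.
move: t2; rewrite ltr_norml => /andP[t1 t2] nt.
have : 0 < n by rewrite -(ltr0z R) nt; lra.
by rewrite gtz0_ge1 -(ler1z R) nt; lra.
Qed.

End Pinch.

(** * The topology of pointwise convergence *)

Section PointwiseTopology.
Variables (X : Type) (Y : topologicalType).

Lemma ptws_cvg (F : set_system (X -> Y)) (f : X -> Y) : Filter F ->
  (forall x A, nbhs (f x) A -> F [set g | A (g x)]) -> {ptws, F --> f}.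
Proof.
move=> FF Ff; apply/cvg_sup => x A [_ [[B oB <-] Bfx BA]].
by apply: (filterS BA); apply: Ff; exact: open_nbhs_nbhs.
Qed.

(** The filter of maps agreeing with [f] on larger and larger finite sets
    converges pointwise to [f]. *)
Lemma ptws_nbhs_agree (f : X -> Y) (A : set {ptws X -> Y}) :
  nbhs (f : {ptws X -> Y}) A -> exists2 S : set X, finite_set S &
    forall g : X -> Y, (forall x, S x -> g x = f x) -> A g.
Proof.
move=> fA; pose F : set_system (X -> Y) := filter_from (@finite_set X)
  (fun S => [set g | forall x, S x -> g x = f x]).
have FF : Filter F.
  apply: filter_from_filter; first by exists set0; exact: finite_set0.
  move=> S T fS fT; exists (S `|` T); first by rewrite finite_setU.
  by move=> g gE; split=> x Sx; apply: gE; [left|right].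
suff FA : F A by case: FA => S fS SA; exists S.
apply: (ptws_cvg FF) fA => x B Bfx; exists [set x]; first exact: finite_set1.
by move=> g /= -> //; exact: nbhs_singleton Bfx.
Qed.

End PointwiseTopology.

(** * The enveloping semigroup is not first countable *)

Section NotTame1.
Variable R : realType.
Local Notation act := (@Hplus_act R).
Local Notation pr := (@circle_proj R).
Local Notation E := (enveloping_semigroup act).

(** Otherwise the interval [[0, 1)], on which the projection is injective,
    would be countable and so of Lebesgue measure zero. *)
Lemma circle_uncountable : ~ countable [set: circle R].
Proof.
move=> /countable_injP[f finj].
have : countable (`[0%R, 1%R[%classic : set R).
  apply/countable_injP; exists (f \o pr) => x y.
  rewrite !inE /= !in_itv /= => /andP[x0 x1] /andP[y0 y1] /finj.
  rewrite !inE => /(_ Logic.I Logic.I)/circle_proj_eqP[n yE].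
  have n1 : n < 1 by rewrite -(ltrz1 R); lra.
  have n2 : -1 < n by rewrite -(ltr_int R) intrN; lra.
  have n0 : n = 0 by lia.
  by rewrite yE n0 addr0.
move=> /countable_lebesgue_measure0; rewrite lebesgue_measure_itv /= lte01.
by rewrite oppr0 adde0 => /eqP; rewrite onee_eq0.
Qed.

(** Adherence to the translations is witnessed by the sequence of
    [pinch_limit]. *)
Lemma pinch_enveloping x : E (pinch x).
Proof.
have [h hE] := pinch_limit x => A pA.
have : {ptws, (fun n => act (h n)) @ \oo --> pinch x}.
  by apply: ptws_cvg => a B; exact: hE.
move=> /(_ A pA) nearA; have [n An] : exists n, A (act (h n)).
  exact: (@filter_ex _ \oo _ (fun n => A (act (h n)))).
by exists (act (h n)); split=> //; exists (h n).
Qed.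

(** On a finite set missing [x], the map [pinch x] agrees with the constant
    map, so every neighbourhood of the constant map is a neighbourhood of
    some [pinch x]. *)
Lemma const_enveloping : E (fun=> pr 0).
Proof.
move=> A /nbhs_interior/ptws_nbhs_agree[S fS SA].
have [x Sx] : exists x, ~ S x.
  apply/existsNP => allS; apply: circle_uncountable.
  apply: finite_set_countable; apply: sub_finite_set fS => x _; exact: allS.
suff : A° (pinch x) by exact: pinch_enveloping.
apply: SA => a Sa; rewrite /pinch; case: eqP => // ax.
by rewrite ax in Sa.
Qed.

(** At the constant map, each member of a countable base constrains a finite
    set of points only, and the union of these sets misses some [x]. *)
Lemma Hplus_not_tame1 : ~ tame1 act.
Proof.
pose c : E := exist _ ((fun=> pr 0) : {ptws circle R -> circle R})
  (mem_set const_enveloping).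
move=> /(_ c)[B [cB Bc Bbase]].
have [S SP] : exists S : set E -> set (circle R), forall U, B U ->
    finite_set (S U) /\
    forall g : E, (forall x, S U x -> set_val g x = pr 0) -> U g.
  suff /choice[S SP] : forall U : set E, exists S : set (circle R), B U ->
      finite_set S /\
      forall g : E, (forall x, S x -> set_val g x = pr 0) -> U g.
    by exists S.
  move=> U; have [BU|] := pselect (B U); last by exists set0.
  have [_ [[W oW <-] Wc WU]] := Bc U BU.
  have /ptws_nbhs_agree[S fS SW] : nbhs (set_val c) W by exact: open_nbhs_nbhs.
  by exists S => _; split=> // g gS; apply: WU; exact: SW.
pose T := \bigcup_(U in B) S U.
have cT : countable T.
  by apply: bigcup_countable => // U /SP[fS _]; exact: finite_set_countable.
have [x Tx] : exists x, ~ T x.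
  by apply/existsNP => allT; apply: circle_uncountable; apply: sub_countable cT;
    apply: subset_card_le => x _; exact: allT.
pose q : E := exist _ (pinch x : {ptws circle R -> circle R})
  (mem_set (@pinch_enveloping x)).
have half : pr 0 <> pr 2^-1.
  move=> /circle_proj_eqP[n]; rewrite add0r => nE.
  have : 0 < n by rewrite -(ltr0z R) -nE; lra.
  by rewrite gtz0_ge1 -(ler1z R) -nE; lra.
have : nbhs c [set g : E | cdist (pr 0) (set_val g x) < cdist (pr 0) (pr 2^-1)].
  have d0 : 0 < cdist (pr 0) (pr 2^-1).
    rewrite lt_neqAle cdist_ge0 andbT eq_sym; apply/eqP.
    by have [_ + _ _] := cdist_is_distance R => /[apply].
  have := @proj_continuous _ (fun=> circle R) x (set_val c) _
    (circle_nbhs_ball _ d0).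
  pose val_E : E -> {ptws circle R -> circle R} := set_val.
  exact: (@initial_continuous _ _ val_E c).
move=> /Bbase[U BU UA].
have /UA /= : U q.
  have [_ SU] := SP U BU; apply: SU => a Sa.
  rewrite /q /= set_valE /= /pinch; case: eqP => // ax.
  by case: Tx; exists U => //; rewrite -ax.
by rewrite set_valE /= /pinch eqxx ltxx.
Qed.

End NotTame1.

Theorem proposition8p10 (R : realType) :
  [/\ dynamical_system R (@Hplus_act R),
      polish R (Hplus R),
      minimal_system (@Hplus_act R) &
      circularly_ordered_system (@circle_order R) (@Hplus_act R)] /\
  (tame R (@Hplus_act R) /\ ~ tame1 (@Hplus_act R)).
Proof.
split; last by split; [exact: Hplus_tame|exact: Hplus_not_tame1].
split; [exact: Hplus_dynamical_system|exact: Hplus_polish|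
        exact: Hplus_minimal|exact: Hplus_circularly_ordered].
Qed.
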